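(* $$\lim_{n \to \infty}\mathbf{Pr}\left[c\left(G\left(n, d/n\right)\right) \ge 1 + \frac{1}{2d} + O\left(\frac{1}{d^2}\right)\right] = 1.$$ Here the $O$-term is to be read as $d \to \infty$: there exist a function $r(d)$ of $d$ alone and constants $C, d_0 > 0$ with $|r(d)| \le C/d^2$ for all real $d \ge d_0$, such that for every fixed real $d \ge d_0$, $\mathbf{Pr}\left[c(G(n,d/n)) \ge 1 + \frac{1}{2d} + r(d)\right] \to 1$ as $n \to \infty$.
   Context: For a positive integer $h$ and a finite simple graph $G$ with $n$ vertices and $k$ connected components, fix one vertex in each connected component of $G$, and let $\mathrm{Lip}(G;h)$ be the set of functions $f: V(G) \to \mathbb{Z}$ such that $f$ takes the value $0$ at each of the fixed vertices and $|f(x)-f(y)| \le h$ for every edge $\{x,y\} \in E(G)$. The cardinality $|\mathrm{Lip}(G;h)|$ does not depend on the choice of fixed vertices. If $k < n$, define $c(G) = \lim_{h\to\infty} \frac{1}{h}\,|\mathrm{Lip}(G;h)|^{1/(n-k)}$ (limit over positive integers $h$; this limit exists). $G(n,p)$ denotes the Erdős–Rényi random graph on $n$ vertices in which each pair of vertices is an edge independently with probability $p$. (The event that $G(n,d/n)$ has no edges, on which $c$ is undefined, has probability tending to $0$ and is irrelevant.) *)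

(* Defs.v *)
From HB Require Import structures.
From mathcomp Require Import all_boot all_order all_algebra.
From mathcomp Require Import finmap.
From mathcomp Require Import all_classical all_reals all_analysis.

Set Implicit Arguments.
Unset Strict Implicit.
Unset Printing Implicit Defensive.

Import Order.TTheory GRing.Theory Num.Theory.
Import numFieldNormedType.Exports.
Local Open Scope classical_set_scope.
Local Open Scope ring_scope.

Record sgraph (T : finType) := SGraph {
  edges :> {set {set T}};
  edges_card2 : [forall e in edges, #|e| == 2%N]
}.

HB.instance Definition _ (T : finType) := [isSub for @edges T].
HB.instance Definition _ (T : finType) := [Finite of sgraph T by <:].

Definition adj (T : finType) (G : sgraph T) : rel T :=
  fun x y => [set x; y]%SET \in edges G.

Lemma adj_sym (T : finType) (G : sgraph T) : symmetric (adj G).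
Proof. by move=> x y; rewrite /adj finset.setUC. Qed.

Lemma adj_irrefl (T : finType) (G : sgraph T) : irreflexive (adj G).
Proof.
move=> x; apply/negP => Gxx.
by have /forall_inP/(_ _ Gxx) := edges_card2 G; rewrite cards2 eqxx.
Qed.

(* One vertex in each connected component: the library's canonical
   representatives of the classes of [connect (adj G)]. *)
Definition fixed_vertices (T : finType) (G : sgraph T) : {set T} :=
  [set x | roots (adj G) x]%SET.

Definition num_components (T : finType) (G : sgraph T) : nat :=
  n_comp (adj G) T.

Definition Lip (T : finType) (G : sgraph T) (S : {set T}) (h : nat) :
    set {ffun T -> int} :=
  [set f : {ffun T -> int} | (forall x, x \in S -> f x = 0) /\
                             (forall x y, adj G x y -> `|f x - f y| <= h%:Z)].

(* [fset_set] of an infinite set is empty, but [Lip G (fixed_vertices G) h] is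
   finite, so this is its true cardinality. *)
Definition card_Lip (T : finType) (G : sgraph T) (h : nat) : nat :=
  #|` fset_set (Lip G (fixed_vertices G) h)|%N.

(* Only meaningful when G has an edge; for edgeless G the exponent is
   0^-1 = 0 and the value is 0. The term h = 0 does not affect the limit. *)
Definition lip_const (R : realType) (T : finType) (G : sgraph T) : R :=
  limn (fun h : nat => h%:R^-1 *
    (card_Lip G h)%:R `^ ((#|T| - num_components G)%N%:R^-1) : R).

(* Probability of the event A for the random graph G(n,p). A probability when
   0 <= p <= 1; for p = d/n this is the case as soon as n >= d. *)
Definition Gnp_Pr (R : realType) (n : nat) (p : R)
    (A : sgraph 'I_n -> Prop) : R :=
  \sum_(G : sgraph 'I_n | `[< A G >])
    \prod_(e : {set 'I_n} | #|e| == 2%N) (if e \in edges G then p else 1 - p).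

(* Main.v *)
(* For h large, assign to the vertices independent uniform values in an interval
   of length (1 + 1/d) h. An edge is violated (values further than h apart) with
   probability about 1/d^2, and there are about nd/2 edges, so if the edges
   behaved independently no edge would be violated with probability about
   exp(-n/(2d)), and the number of Lipschitz functions would be at least
   ((1 + 1/d) exp(-1/(2d)) h)^n = (1 + 1/(2d) + O(1/d^2))^n h^n.

   Rosenfeld's counting argument makes this rigorous: adding the vertices one by
   one, each new vertex v costs a factor at least exp(-lam b), with b its number of
   earlier neighbours and lam = (1 + O(1/d)) / d^2. It needs a bound on the
   degrees; the O(n/d) vertices whose degree is not within d/2 of d are therefore
   confined to the central values, which violate no edge at all. The same
   vertices control the number of components. Efron-Stein and Chebyshev bound,
   with high probability, a single graph statistic combining the number of edges
   and the number of atypical vertices.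

   The limit defining c(G) exists because division by m with remainder gives
   |Lip(G; h m)| <= m^(n-k) |Lip(G; h)|. *)
Require Import Defs.
From HB Require Import structures.
From mathcomp Require Import all_boot all_order all_algebra.
From mathcomp Require Import finmap.
From mathcomp Require Import all_classical all_reals all_analysis.
From mathcomp Require Import ring lra zify.

Set Implicit Arguments.
Unset Strict Implicit.
Unset Printing Implicit Defensive.

Import Order.TTheory GRing.Theory Num.Theory.
Import numFieldNormedType.Exports.
Local Open Scope classical_set_scope.
Local Open Scope ring_scope.

(** * Random subsets with independent elements: mean, variance, deviation *)

(* Elements of s are resampled one at a time, so that the variance can be bounded
   by induction on s; subset_meanE gives the product-measure form. *)
Fixpoint subset_mean (R : realType) (E : finType) (p : R) (s : seq E)
    (f : {set E} -> R) (S : {set E}) : R :=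
  if s is e :: s' then
    p * subset_mean p s' f (e |: S)%SET +
    (1 - p) * subset_mean p s' f (S :\ e)%SET
  else f S.

Lemma subset_meanD (R : realType) (E : finType) (p : R) s (f g : {set E} -> R) S :
  subset_mean p s (fun F => f F + g F) S =
  subset_mean p s f S + subset_mean p s g S.
Proof. elim: s S => [|e s IH] S //=; rewrite !IH; ring. Qed.

Lemma subset_meanZ (R : realType) (E : finType) (p a : R) s (f : {set E} -> R) S :
  subset_mean p s (fun F => a * f F) S = a * subset_mean p s f S.
Proof. elim: s S => [|e s IH] S //=; rewrite !IH; ring. Qed.

Lemma subset_mean_cst (R : realType) (E : finType) (p a : R) s (S : {set E}) :
  subset_mean p s (fun=> a) S = a.
Proof. elim: s S => [|e s IH] S //=; rewrite !IH; ring. Qed.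

Lemma subset_mean_sum (R : realType) (E I : finType) (p : R) s
    (f : I -> {set E} -> R) S :
  subset_mean p s (fun F => \sum_i f i F) S = \sum_i subset_mean p s (f i) S.
Proof.
elim: s S => [|e s IH] S //=.
by rewrite !IH !mulr_sumr -big_split.
Qed.

Lemma subset_mean_mem (R : realType) (E : finType) (p : R) (s : seq E) a S :
  uniq s ->
  subset_mean p s (fun F => (a \in F)%:R) S = if a \in s then p else (a \in S)%:R.
Proof.
elim: s S => [|e s IH] S //= /andP[es us].
rewrite !IH // !inE; case: (eqVneq a e) => [->|ae] /=.
  by rewrite (negbTE es) /=; ring.
case: (a \in s) => /=; ring.
Qed.

Lemma le_subset_mean (R : realType) (E : finType) (p : R) s (f g : {set E} -> R) S :
  0 <= p <= 1 -> (forall F, f F <= g F) ->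
  subset_mean p s f S <= subset_mean p s g S.
Proof.
move=> /andP[p0 p1] fg; elim: s S => [|e s IH] S //=.
by rewrite lerD // ler_wpM2l // subr_ge0.
Qed.

(** Resampling elements other than [e] commutes with inserting or deleting [e], so the left side is
    the absolute value of an average of differences of [f]. *)
Lemma subset_mean_dist (R : realType) (E : finType) (p : R) (s : seq E) e
    (f : {set E} -> R) (c : R) S :
  0 <= p <= 1 -> e \notin s ->
  (forall F, `|f (e |: F)%SET - f (F :\ e)%SET| <= c) ->
  `|subset_mean p s f (e |: S)%SET - subset_mean p s f (S :\ e)%SET| <= c.
Proof.
move=> /andP[p0 p1] + fc; elim: s S => [|x s IH] S //=.
rewrite inE negb_or => /andP[ex es].
have -> : (x |: (e |: S) = e |: (x |: S))%SET by rewrite finset.setUCA.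
have -> : (x |: S :\ e = (x |: S) :\ e)%SET.
  by apply/setP => y; rewrite !inE; case: (eqVneq y x) => // ->; rewrite eq_sym ex.
have -> : ((e |: S) :\ x = e |: (S :\ x))%SET.
  by apply/setP => y; rewrite !inE; case: (eqVneq y e) => // ->; rewrite ex.
have -> : (S :\ e :\ x = S :\ x :\ e)%SET.
  by apply/setP => y; rewrite !inE; case: (y == x); case: (y == e).
have := IH (x |: S)%SET es; have := IH (S :\ x)%SET es.
move: (subset_mean _ _ _ _) (subset_mean _ _ _ _) => a b.
move: (subset_mean _ _ _ _) (subset_mean _ _ _ _) => a' b'.
rewrite !ler_norml => /andP[? ?] /andP[? ?]; apply/andP; split; nra.
Qed.

(* Efron-Stein for functions with bounded differences. *)
Lemma subset_mean_var (R : realType) (E : finType) (p : R) (s : seq E)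
    (f : {set E} -> R) (c : E -> R) S :
  0 <= p <= 1 -> uniq s ->
  (forall e F, e \in s -> `|f (e |: F)%SET - f (F :\ e)%SET| <= c e) ->
  subset_mean p s (fun F => f F ^+ 2) S - subset_mean p s f S ^+ 2 <=
  (\sum_(x <- s) p * c x ^+ 2).
Proof.
move=> p01 + fc; elim: s S fc => [|e s IH] S fc /=; first by rewrite big_nil subrr.
case/andP=> es us.
have fcs x F : x \in s -> `|f (x |: F)%SET - f (F :\ x)%SET| <= c x.
  by move=> xs; apply: fc; rewrite inE xs orbT.
have H1 := IH (e |: S)%SET fcs us; have H2 := IH (S :\ e)%SET fcs us.
have := subset_mean_dist S p01 es (fun F => fc e F (mem_head e s)).
move: H1 H2.
move: (subset_mean p s f _) (subset_mean p s f _) => b a.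
move: (subset_mean _ _ _ _) (subset_mean _ _ _ _) => b' a'.
move=> H1 H2 ab; case/andP: p01 => p0 p1.
have c0 : 0 <= c e by apply: le_trans ab.
have : (a - b) ^+ 2 <= c e ^+ 2 by rewrite -(real_normK (num_real (a - b))) lerXn2r ?nnegrE.
rewrite big_cons; set n := \sum_(x <- s) _ in H1 H2 *.
move=> abc.
have q0 : 0 <= 1 - p by rewrite subr_ge0.
(* Conditioning on [e] splits the variance into the averaged conditional variances, bounded by
   induction, plus [p * (1 - p) * (a - b) ^+ 2], where [a] and [b] are the conditional means. *)
have pab : p * (1 - p) * (a - b) ^+ 2 <= p * c e ^+ 2.
  apply: le_trans (_ : p * (1 - p) * c e ^+ 2 <= _).
    by rewrite ler_wpM2l // mulr_ge0.
  by rewrite ler_wpM2r ?sqr_ge0 // ler_piMr // lerBlDr lerDl.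
have := ler_wpM2l p0 H2; have := ler_wpM2l q0 H1; have := ler_wpM2l p0 H1; have := ler_wpM2l q0 H2.
move: pab; nra.
Qed.

Lemma subset_mean_chebyshev (R : realType) (E : finType) (p : R) (s : seq E)
    (f : {set E} -> R) (c : E -> R) (t : R) S :
  0 <= p <= 1 -> uniq s -> 0 < t ->
  (forall e F, e \in s -> `|f (e |: F)%SET - f (F :\ e)%SET| <= c e) ->
  1 - (\sum_(x <- s) p * c x ^+ 2) / t ^+ 2 <=
  subset_mean p s (fun F => (f F <= subset_mean p s f S + t)%R%:R) S.
Proof.
move=> p01 us t0 fc; set m := subset_mean p s f S.
apply: le_trans (_ : 1 - subset_mean p s (fun F => (f F - m) ^+ 2) S / t ^+ 2 <= _).
  rewrite lerD2l lerN2 ler_pM2r ?invr_gt0 ?exprn_gt0 //.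
  apply: le_trans (subset_mean_var S p01 us fc).
  have -> : (fun F => (f F - m) ^+ 2) =
     (fun F => f F ^+ 2 + ((- (m + m)) * f F + m ^+ 2)) by apply: funext => F; ring.
  by rewrite !subset_meanD subset_meanZ subset_mean_cst -/m; lra.
(* Pointwise, [1 - (f F - m) ^+ 2 / t ^+ 2] is at most the indicator of [f F <= m + t]. *)
have -> : 1 - subset_mean p s (fun F => (f F - m) ^+ 2) S / t ^+ 2 =
  subset_mean p s (fun F => 1 + (- (t ^+ 2)^-1) * (f F - m) ^+ 2) S.
  by rewrite subset_meanD subset_meanZ subset_mean_cst; ring.
apply: le_subset_mean => // F.
have [_|] := leP (f F) (m + t).
  by rewrite mulNr lerBlDr lerDl mulr_ge0 ?invr_ge0 ?sqr_ge0.
move=> ft; rewrite mulNr lerBlDr add0r ler_pdivlMl ?exprn_gt0 // mulr1.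
by rewrite lerXn2r ?nnegrE; lra.
Qed.

Lemma subset_meanE (R : realType) (E : finType) (p : R) (s : seq E)
    (f : {set E} -> R) :
  uniq s ->
  subset_mean p s f finset.set0 =
  \sum_(F : {set E} | F \subset s)
    (\prod_(e <- s) (if e \in F then p else 1 - p)) * f F.
Proof.
move=> us.
(* The induction inserts [e] into the starting set, so the claim is generalised to starting sets
   disjoint from [s]. *)
suff H (S : {set E}) : {in s, forall x, x \notin S} -> subset_mean p s f S =
  \sum_(F : {set E} | F \subset s)
    (\prod_(e <- s) (if e \in F then p else 1 - p)) * f (S :|: F)%SET.
  rewrite H; last by move=> x _; rewrite inE.
  by under eq_bigr => F _ do rewrite finset.set0U.
elim: s us S => [|e s IH] /= us S dS.
  rewrite (big_pred1 finset.set0) ?big_nil ?mul1r ?finset.setU0 //.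
  move=> F /=; rewrite -finset.subset0; apply: eq_subset_r => x; by rewrite !inE.
case/andP: us => es us.
have eS : e \notin S by apply: dS; rewrite inE eqxx.
have dSs : {in s, forall x, x \notin S}.
  by move=> x xs; apply: dS; rewrite inE xs orbT.
have dSe : {in s, forall x, x \notin (e |: S)%SET}.
  move=> x xs; rewrite !inE negb_or dSs // andbT.
  by apply: contraNneq es => <-.
have -> : (S :\ e = S)%SET.
  by apply/setP => x; rewrite !inE; case: (eqVneq x e) => // ->; rewrite (negbTE eS).
(* Subsets containing [e] are reindexed by deleting [e]; the others are the subsets of [s]. *)
rewrite !IH // [in RHS](bigID (fun F : {set E} => e \in F)) /= !mulr_sumr; congr (_ + _).
  rewrite [RHS](reindex_onto (fun F : {set E} => e |: F)%SET
    (fun F : {set E} => F :\ e)%SET) /=; last first.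
    by move=> F /andP[_ eF]; apply/setP => x; rewrite !inE; case: (eqVneq x e) => // ->.
  apply: eq_big => F.
    apply/idP/idP.
      move=> Fs; apply/andP; split; [apply/andP; split|].
      - apply/fintype.subsetP => x; rewrite !inE; case: (x == e) => //= xF.
        by apply: (fintype.subsetP Fs).
      - by rewrite !inE eqxx.
      - apply/eqP/setP => x; rewrite !inE; case: (eqVneq x e) => //= ->.
        by apply/esym/negP => /(fintype.subsetP Fs); rewrite (negbTE es).
    case/andP=> /andP[Fs _] /eqP Fe; apply/fintype.subsetP => x xF.
    have xe : x != e by move: xF; rewrite -Fe !inE => /andP[].
    have := fintype.subsetP Fs x; rewrite !inE xF orbT (negbTE xe) /=; exact.
  move=> Fs; rewrite big_cons !inE eqxx mulrA; congr (_ * _ * _).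
    apply: eq_big_seq => x xs; rewrite !inE; case: eqVneq xs => // ->.
    by rewrite (negbTE es).
  by congr f; apply/setP => x; rewrite !inE; case: (x == e); case: (x \in S).
apply: eq_big => F.
  apply/idP/idP.
    move=> Fs; apply/andP; split.
      by apply/fintype.subsetP => x /(fintype.subsetP Fs) xs; rewrite inE xs orbT.
    by apply/negP => /(fintype.subsetP Fs); rewrite (negbTE es).
  case/andP=> Fs eF; apply/fintype.subsetP => x xF.
  have := fintype.subsetP Fs x xF; rewrite inE => /orP[/eqP xe|//].
  by rewrite -xe xF in eF.
move=> Fs; rewrite big_cons mulrA; congr (_ * _ * _).
by case: ifP => // /(fintype.subsetP Fs); rewrite (negbTE es).
Qed.

(** * Degrees in the random graph *)

Definition pair_seq (T : finType) : seq {set T} := enum [pred e : {set T} | #|e| == 2%N].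

Lemma mem_pair_seq (T : finType) (e : {set T}) : (e \in pair_seq T) = (#|e| == 2%N).
Proof. by rewrite mem_enum inE. Qed.

(** The subsets of [pair_seq] are exactly the edge sets of simple graphs; this carries the random
    graph over to the product measure. *)
Lemma sum_sgraph (R : realType) (n : nat) (p : R) (f : {set {set 'I_n}} -> R) :
  \sum_(G : sgraph 'I_n)
    (\prod_(e : {set 'I_n} | #|e| == 2%N) (if e \in edges G then p else 1 - p)) *
    f (edges G) =
  subset_mean p (pair_seq 'I_n) f finset.set0.
Proof.
rewrite subset_meanE ?enum_uniq // [RHS](reindex_omap (@edges 'I_n) insub); last first.
  move=> F sF; case: insubP => [G _ <- //|]; case/negP.
  apply/forallP => e; apply/implyP => eF.
  by have := fintype.subsetP sF e eF; rewrite mem_pair_seq.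
apply: eq_big => [G|G _].
  have -> /= : insub (edges G) = Some G by rewrite -[edges G]/(val G) valK.
  rewrite eqxx andbT; apply/esym/fintype.subsetP => e eG.
  by rewrite mem_pair_seq; have /forall_inP/(_ e eG) := edges_card2 G.
by rewrite big_enum.
Qed.

Lemma Gnp_Pr_le1 (R : realType) (n : nat) (p : R) (A : sgraph 'I_n -> Prop) :
  0 <= p <= 1 -> Gnp_Pr p A <= 1.
Proof.
move=> /andP[p0 p1].
have w0 (G : sgraph 'I_n) :
    0 <= \prod_(e : {set 'I_n} | #|e| == 2%N) (if e \in edges G then p else 1 - p).
  by apply: prodr_ge0 => e _; case: ifP; rewrite ?subr_ge0.
rewrite -(subset_mean_cst p 1 (pair_seq 'I_n) finset.set0) -sum_sgraph.
rewrite /Gnp_Pr big_mkcond; apply: ler_sum => G _; rewrite mulr1.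
by case: ifP.
Qed.

Lemma le_Gnp_Pr (R : realType) (n : nat) (p : R) (A : sgraph 'I_n -> Prop)
    (b : {set {set 'I_n}} -> bool) :
  0 <= p <= 1 -> (forall G, b (edges G) -> A G) ->
  subset_mean p (pair_seq 'I_n) (fun F => (b F)%:R) finset.set0 <= Gnp_Pr p A.
Proof.
move=> /andP[p0 p1] bA.
have w0 (G : sgraph 'I_n) :
    0 <= \prod_(e : {set 'I_n} | #|e| == 2%N) (if e \in edges G then p else 1 - p).
  by apply: prodr_ge0 => e _; case: ifP; rewrite ?subr_ge0.
rewrite -sum_sgraph /Gnp_Pr [leRHS]big_mkcond; apply: ler_sum => G _.
have := bA G; case: (b _) => /= [/(_ isT)/asboolT->|_]; rewrite ?mulr1 ?mulr0 //.
by case: ifP.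
Qed.

(** Defined for arbitrary families of sets, since resampling works with families [F] that are not
    packaged as graphs. *)
Definition degree (T : finType) (F : {set {set T}}) (v : T) : nat :=
  \sum_(u | u != v) ([set v; u]%SET \in F).

Lemma degree_flip (T : finType) (F : {set {set T}}) (e : {set T}) v :
  (degree F v <= degree (e |: F) v <= degree F v + (v \in e))%N.
Proof.
apply/andP; split.
  by apply: leq_sum => u _; rewrite inE; case: (_ \in F); rewrite ?orbT.
have H : (\sum_(u | u != v) ([set v; u]%SET == e) <= (v \in e))%N.
  case: (boolP [exists u, (u != v) && ([set v; u]%SET == e)]).
    case/existsP => w /andP[wv /eqP <-]; rewrite !inE eqxx (bigD1 w) //= eqxx.
    rewrite big1 ?addn0 // => u /andP[uv uw]; apply/eqP; rewrite eqb0.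
    apply/negP => /eqP/setP/(_ u); rewrite !inE eqxx orbT (negbTE uv) (negbTE uw) //.
  move/existsPn => He; rewrite big1 // => u uv.
  by have := He u; rewrite uv /= => /negbTE->.
rewrite addnC; apply: leq_trans (leq_add H (leqnn _)); rewrite -big_split /=.
by apply: leq_sum => u _; rewrite !inE; case: eqP; case: (_ \in F).
Qed.

Lemma degree_flip_dist (R : realType) (T : finType) (F : {set {set T}}) (e : {set T}) v
    (phi : nat -> R) (K : R) :
  (forall a, `|phi a.+1 - phi a| <= K) ->
  `|phi (degree (e |: F)%SET v) - phi (degree (F :\ e)%SET v)| <= K * (v \in e)%:R.
Proof.
move=> phiK; have := degree_flip (F :\ e)%SET e v.
have -> : (e |: F :\ e = e |: F)%SET.
  by apply/setP => x; rewrite !inE; case: (x == e).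
have K0 : 0 <= K by apply: le_trans (phiK 0%N).
case/andP => d1; case: (v \in e) => d2; rewrite ?mulr1 ?mulr0.
  move: d2; rewrite addn1 leq_eqVlt => /orP[/eqP->//|]; rewrite ltnS => d2.
  have -> : degree (e |: F) v = degree (F :\ e) v by apply/eqP; rewrite eqn_leq d2.
  by rewrite subrr normr0.
have -> : degree (e |: F) v = degree (F :\ e) v.
  by apply/eqP; rewrite eqn_leq d1 -[leqRHS]addn0 d2.
by rewrite subrr normr0.
Qed.

Lemma mean_degree (R : realType) (T : finType) (p : R) (v : T) :
  subset_mean p (pair_seq T) (fun F => (degree F v)%:R) finset.set0 = (#|T|.-1)%:R * p.
Proof.
have -> : (fun F => (degree F v)%:R : R) =
    (fun F => \sum_u (u != v)%:R * ([set v; u]%SET \in F)%:R).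
  apply: funext => F; rewrite /degree natr_sum big_mkcond; apply: eq_bigr => u _.
  by case: (u != v); rewrite ?mul1r ?mul0r.
rewrite subset_mean_sum.
under eq_bigr => u _ do rewrite subset_meanZ subset_mean_mem ?enum_uniq // mem_pair_seq cards2.
transitivity (\sum_(u | u != v) p).
  rewrite [RHS]big_mkcond; apply: eq_bigr => u _.
  by rewrite eq_sym; case: (v != u); rewrite ?mul1r ?mul0r.
by rewrite sumr_const cardC1 mulr_natl.
Qed.

Lemma card_pairs_mem (T : finType) (v : T) :
  (\sum_(e <- pair_seq T) (v \in e) <= #|T|)%N.
Proof.
rewrite big_enum /= -big_mkcondr /= sum1_card.
apply: leq_trans (leq_imset_card (fun u => [set v; u]%SET) T).
apply: subset_leq_card; apply/fintype.subsetP => e.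
rewrite unfold_in /= => /andP[/cards2P[x [y [xy ->]]]]; rewrite !inE => /orP[]/eqP->.
  by apply: imset_f.
by rewrite finset.setUC; apply: imset_f.
Qed.

Lemma card_pairs (T : finType) : (size (pair_seq T) <= #|T| ^ 2)%N.
Proof.
rewrite -cardE; have := card_draws T 2; rewrite cardsE => ->.
rewrite bin2; apply: leq_trans (_ : #|T| * #|T|.-1 <= _)%N.
  by rewrite -[leqRHS]odd_double_half -addnn addnCA leq_addr.
by rewrite -mulnn leq_mul2l leq_pred orbT.
Qed.

(** Efron-Stein bounds the variance by [d]. The mean is [d - p] rather than [d], and the squared
    bias [p ^+ 2] accounts for the extra 1. *)
Lemma var_degree (R : realType) (T : finType) (p d : R) (v : T) :
  0 <= p <= 1 -> #|T|%:R * p = d ->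
  subset_mean p (pair_seq T) (fun F => ((degree F v)%:R - d) ^+ 2) finset.set0 <= d + 1.
Proof.
move=> p01 npd.
have -> : (fun F => ((degree F v)%:R - d) ^+ 2) = (fun F =>
    (degree F v)%:R ^+ 2 + ((- (d + d)) * (degree F v)%:R + d ^+ 2)).
  by apply: funext => F; ring.
have := @subset_mean_var R _ p (pair_seq T) (fun F => (degree F v)%:R)
   (fun e => (v \in e)%:R) finset.set0 p01 (enum_uniq _).
have flip e F : e \in pair_seq T ->
    `|(degree (e |: F)%SET v)%:R - (degree (F :\ e)%SET v)%:R| <= (v \in e)%:R :> R.
  move=> _; rewrite -[leRHS]mul1r.
  apply: (@degree_flip_dist R T F e v (fun a => a%:R)) => a.
  by rewrite -natr1 addrAC subrr add0r normr1.
move=> /(_ flip).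
rewrite !subset_meanD subset_meanZ subset_mean_cst mean_degree.
have H : \sum_(e <- pair_seq T) p * (v \in e)%:R ^+ 2 <= d.
  rewrite -npd -mulr_sumr mulrC ler_wpM2r //; first by case/andP: p01.
  apply: le_trans (_ : (\sum_(e <- pair_seq T) (v \in e))%:R <= _).
    by rewrite natr_sum; apply: ler_sum => e _; case: (v \in e); rewrite ?expr1n ?expr0n.
  by rewrite ler_nat card_pairs_mem.
move=> H2; have := le_trans H2 H.
have -> : #|T|.-1%:R * p = d - p.
  have T0 : (0 < #|T|)%N by apply/card_gt0P; exists v.
  by rewrite -npd -{2}(prednK T0) -natr1; ring.
case/andP: p01 => p0 p1.
have : p ^+ 2 <= 1 by rewrite expr_le1.
lra.
Qed.

Definition atypical (R : realType) (d : R) (k : nat) : bool := d / 2 < `|k%:R - d|.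

(** The halves add up to the number of edges. An atypical vertex costs [3 / d] in the final exponent
    for its confinement and up to [1 / d] as a possible extra component, while an edge costs about
    [1 / d ^+ 2]; hence the relative weight [4 * d]. *)
Definition degree_cost (R : realType) (d : R) (k : nat) : R :=
  k%:R / 2 + 4 * d * (atypical d k)%:R.

Definition graph_cost (R : realType) (T : finType) (d : R) (F : {set {set T}}) : R :=
  \sum_v degree_cost d (degree F v).

Lemma degree_cost_dist (R : realType) (d : R) (k : nat) :
  0 <= d -> `|degree_cost d k.+1 - degree_cost d k| <= 1 / 2 + 4 * d.
Proof.
move=> d0; rewrite /degree_cost -natr1 ler_norml.
by case: (atypical d k); case: (atypical d k.+1) => /=; apply/andP; split; lra.
Qed.

Lemma graph_cost_flip (R : realType) (T : finType) (d : R) (F : {set {set T}}) (e : {set T}) :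
  0 <= d -> #|e| = 2%N ->
  `|graph_cost d (e |: F)%SET - graph_cost d (F :\ e)%SET| <= 1 + 8 * d.
Proof.
move=> d0 e2; rewrite /graph_cost -sumrB; apply: le_trans (ler_norm_sum _ _ _) _.
apply: le_trans (_ : \sum_v (1 / 2 + 4 * d) * (v \in e)%:R <= _).
  apply: ler_sum => v _; apply: degree_flip_dist => a; exact: degree_cost_dist.
rewrite -mulr_sumr -natr_sum -(big_mkcond (mem e) (fun=> 1%N)) /= sum1_card e2; lra.
Qed.

(** As in Chebyshev's inequality, [4 * d] times the atypicality indicator is at most [16 / d] times
    the squared deviation of the degree, whose mean is at most [d + 1]. *)
Lemma mean_graph_cost (R : realType) (T : finType) (p d : R) :
  0 <= p <= 1 -> 1 <= d -> #|T|%:R * p = d ->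
  subset_mean p (pair_seq T) (graph_cost d) finset.set0 <= #|T|%:R * (d / 2 + 32).
Proof.
move=> p01 d1 npd; rewrite subset_mean_sum.
rewrite mulr_natl -sumr_const; apply: ler_sum => v _.
apply: le_trans (_ : subset_mean p (pair_seq T) (fun F =>
   1 / 2 * (degree F v)%:R + 16 / d * ((degree F v)%:R - d) ^+ 2) finset.set0 <= _).
  apply: le_subset_mean => // F; rewrite /degree_cost mulrC lerD ?div1r //.
  have [|_] := boolP (atypical _ _); last first.
    by rewrite mulr0 mulr_ge0 ?sqr_ge0 // divr_ge0 //; lra.
  rewrite /atypical => h; rewrite mulr1 -(real_normK (num_real (_ - d))).
  have := lerXn2r 2; move/(_ R (d / 2) `|(degree F v)%:R - d|).
  rewrite !nnegrE normr_ge0 (ltW h) => /(_ _ isT isT); move: (`| _ |) => x H.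
  have {}H : (d / 2) ^+ 2 <= x ^+ 2 by apply: H; lra.
  rewrite mulrAC ler_pdivlMr; last lra.
  by move: H; nra.
rewrite subset_meanD !subset_meanZ mean_degree.
have := var_degree v p01 npd; set V := subset_mean _ _ _ _ => HV.
have : #|T|.-1%:R * p <= d.
  by rewrite -npd ler_wpM2r ?ler_nat ?leq_pred //; case/andP: p01.
have : 16 / d * V <= 32.
  by rewrite mulrAC ler_pdivrMr; [lra|lra].
lra.
Qed.

(** Chebyshev with deviation [n], which raises the constant 32 of the mean to 33; there are at most
    [n ^ 2] pairs, each of probability [d / n]. *)
Lemma graph_cost_whp (R : realType) (n : nat) (d : R) :
  1 <= d -> d <= n%:R ->
  1 - d * (1 + 8 * d) ^+ 2 / n%:R <=
  subset_mean (d / n%:R) (pair_seq 'I_n)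
    (fun F => (graph_cost d F <= n%:R * (d / 2 + 33))%R%:R) finset.set0.
Proof.
move=> d1 dn; have n0 : 0 < n%:R :> R by lra.
have p01 : 0 <= d / n%:R <= 1.
  by rewrite divr_ge0 ?ler_pdivrMr ?mul1r //; lra.
have npd : #|'I_n|%:R * (d / n%:R) = d.
  by rewrite card_ord mulrCA divff ?mulr1 // gt_eqF.
have := @subset_mean_chebyshev R _ (d / n%:R) (pair_seq 'I_n) (graph_cost d)
  (fun=> 1 + 8 * d) n%:R finset.set0 p01 (enum_uniq _) n0.
have flip e F : e \in pair_seq 'I_n ->
  `|graph_cost d (e |: F)%SET - graph_cost d (F :\ e)%SET| <= 1 + 8 * d.
  by rewrite mem_pair_seq => /eqP; apply: graph_cost_flip; lra.
move=> /(_ flip) H; apply: le_trans (le_trans H _).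
  rewrite lerD2l lerN2 ler_pdivrMr ?exprn_gt0 //.
  rewrite [leRHS](_ : _ = d / n%:R * (1 + 8 * d) ^+ 2 * n%:R ^+ 2); last by field; lra.
  rewrite big_const_seq count_predT iter_addr_0 -[leLHS]mulr_natr ler_wpM2l //.
    by rewrite mulr_ge0 ?sqr_ge0 //; case/andP: p01.
  by rewrite -natrX ler_nat -[in leqRHS](card_ord n) card_pairs.
apply: le_subset_mean => // F; rewrite ler_nat.
have [h|//] := leP (graph_cost d F) _.
rewrite (le_trans h) // (le_trans (lerD (mean_graph_cost p01 d1 npd) (lexx _))) //.
by rewrite card_ord; lra.
Qed.

(** * Existence of the limit *)

Lemma ler_dist_divz (a b : int) (h m : nat) : (0 < m)%N ->
  `|a - b| <= (h * m)%:Z -> `|(a %/ m%:Z)%Z - (b %/ m%:Z)%Z| <= h%:Z.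
Proof.
move=> m0; rewrite {1}(divz_eq a m%:Z) {1}(divz_eq b m%:Z).
have mz : m%:Z != 0 by lia.
have mp : 0 < m%:Z by lia.
have := modz_ge0 a mz; have := modz_ge0 b mz.
have := ltz_pmod a mp; have := ltz_pmod b mp.
move: (a %/ _)%Z (b %/ _)%Z (a %% _)%Z (b %% _)%Z => q q' r r'.
rewrite PoszM => rm r'm r0 r'0; rewrite !ler_norml => /andP[H1 H2].
by apply/andP; split; rewrite leNgt; apply/negP => H; nia.
Qed.

(** Serves for both upper bounds in terms of [card_Lip]: [phi] produces a Lipschitz function and
    [psi] records what [phi] forgets. *)
Lemma leq_card_fset_set (X F : finType) (K : choiceType) (P : set K)
    (phi : X -> K) (psi : X -> F) :
  finite_set P -> (forall x, P (phi x)) ->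
  (forall x y, phi x = phi y -> psi x = psi y -> x = y) ->
  (#|X| <= #|` fset_set P| * #|F|)%N.
Proof.
move=> finP Pphi inj.
have mem x : phi x \in fset_set P by rewrite in_fset_set // inE.
rewrite cardfE -card_prod.
apply: (@leq_card _ _ (fun x => ([` mem x]%fset, psi x))) => x y [/=].
exact: inj.
Qed.

Lemma Lip_path (T : finType) (G : sgraph T) S h (f : {ffun T -> int}) x p :
  Lip G S h f -> path (adj G) x p -> `|f x - f (last x p)| <= (h * size p)%:Z.
Proof.
case=> _ Lf; elim: p x => [|y p IH] x /=; first by rewrite subrr muln0.
by case/andP => /Lf xy /IH; move: xy; lia.
Qed.

Lemma Lip_bounded (T : finType) (G : sgraph T) h (f : {ffun T -> int}) x :
  Lip G (fixed_vertices G) h f -> `|f x| <= (h * #|T|)%:Z.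
Proof.
move=> Lf.
(* A repetition-free path to the root, where [f] vanishes, has fewer than [#|T|] edges. *)
have /connectP[p0 pp0] := connect_root (adj G) x.
case/shortenP: pp0 => p pp up _ Er.
have := Lip_path Lf pp; rewrite -Er.
have -> : f (fingraph.root (adj G) x) = 0.
  case: Lf => f0 _; apply: f0.
  by rewrite inE roots_root //; apply/sym_connect_sym/adj_sym.
rewrite subr0 => /le_trans; apply; rewrite lez_nat leq_mul2l; apply/orP; right.
by have := max_card (mem (x :: p)); rewrite (card_uniqP up) => /ltnW.
Qed.

Lemma finite_Lip (T : finType) (G : sgraph T) h :
  finite_set (Lip G (fixed_vertices G) h).
Proof.
set B := (h * #|T|)%N.
pose g (k : {ffun T -> 'I_(B + B).+1}) : {ffun T -> int} :=
  [ffun x => (k x)%:Z - B%:Z].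
apply: (@sub_finite_set _ _ (g @` setT)); last exact/finite_image/finite_finset.
move=> f Lf; exists [ffun x => inord `|(f x + B%:Z)%R|%N] => //.
apply/ffunP => x; rewrite !ffunE.
have := Lip_bounded x Lf; rewrite -/B => fB.
by rewrite inordK; lia.
Qed.

Lemma card_nonfixed (T : finType) (G : sgraph T) :
  (#|T| - num_components G)%N = #|~: fixed_vertices G|%SET.
Proof.
rewrite cardsCs finset.setCK; congr (_ - _)%N.
by apply: eq_card => x; rewrite !inE andbT.
Qed.

Lemma card_Lip_mono (T : finType) (G : sgraph T) h k :
  (h <= k)%N -> (card_Lip G h <= card_Lip G k)%N.
Proof.
move=> hk; apply/fsubset_leq_card/fsubsetP => f.
rewrite !in_fset_set ?inE; try exact: finite_Lip.
case=> f0 fh; split=> // x y /fh; lia.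
Qed.

(* The pointwise quotient by m maps [Lip G S (h * m)] to [Lip G S h]; a function
   is determined by its quotient and its remainders off the fixed vertices. *)
Lemma card_Lip_mul (T : finType) (G : sgraph T) h m :
  (0 < m)%N ->
  (card_Lip G (h * m) <= card_Lip G h * m ^ (#|T| - num_components G))%N.
Proof.
case: m => // m _; rewrite card_nonfixed.
set S := fixed_vertices G; set X := fset_set (Lip G S (h * m.+1)).
have XL (f : X) : Lip G S (h * m.+1) (val f).
  by have := valP f; rewrite in_fset_set ?inE //; exact: finite_Lip.
rewrite /card_Lip cardfE -/X.
have -> : (m.+1 ^ #|~: S|%SET)%N = #|{ffun {x | x \in (~: S)%SET} -> 'I_m.+1}|.
  by rewrite card_ffun card_ord card_sig.
apply: (@leq_card_fset_set X _ _ _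
  (fun f => [ffun x => (val f x %/ m.+1%:Z)%Z])
  (fun f => [ffun x => inord `|(val f (val x) %% m.+1%:Z)%Z|%N])).
- exact: finite_Lip.
- move=> f; have [f0 fh] := XL f; split=> [x xS|x y xy]; rewrite !ffunE.
    by rewrite f0 // div0z.
  exact: ler_dist_divz (fh x y xy).
move=> f g /ffunP fg1 /ffunP fg2; apply/val_inj/ffunP => x.
have [xS|xS] := boolP (x \in S).
  by rewrite (XL f).1 // (XL g).1.
have xC : x \in (~: S)%SET by rewrite inE.
have := fg1 x; rewrite !ffunE => fgd.
have := congr1 val (fg2 (exist _ x xC)); rewrite !ffunE /= !inordK; try lia.
move=> fgm; rewrite (divz_eq (val f x) m.+1%:Z) (divz_eq (val g x) m.+1%:Z) fgd.
congr (_ + _).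
have mz : m.+1%:Z != 0 by [].
rewrite -(gez0_abs (modz_ge0 (val f x) mz)) -(gez0_abs (modz_ge0 (val g x) mz)).
exact (congr1 Posz fgm).
Qed.

(** The limit is the infimum over positive indices: fix [h] with [u h] close to it and let [k]
    grow. *)
Lemma cvgn_almost_monotone (R : realType) (u : nat -> R) :
  (forall h, 0 <= u h) ->
  (forall h k, (0 < h)%N -> (0 < k)%N -> u k <= (1 + h%:R / k%:R) * u h) ->
  cvgn u.
Proof.
move=> u0 uS; pose A := [set u h | h in [set h | (0 < h)%N]].
have Ainf : has_inf A.
  by split; [exists (u 1%N); exists 1%N|exists 0 => _ [h _ <-]].
apply/cvg_ex; exists (inf A); apply/cvgrPdist_lt => e e0.
have [_ [h /= h0 <-] uh] := inf_adherent (divr_gt0 e0 (ltr0n R 2)) Ainf.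
near=> k.
have k0 : (0 < k)%N by near: k; exact: nbhs_infty_gt.
have Ak : inf A <= u k by apply: ge_inf; [exact: Ainf.2|exists k].
rewrite distrC ger0_norm ?subr_ge0 // ltrBlDl.
apply: le_lt_trans (uS h k h0 k0) _.
have : h%:R / k%:R * u h < e / 2.
  rewrite mulrAC ltr_pdivrMr ?ltr0n // -ltr_pdivrMl ?divr_gt0 //.
  by near: k; exact: nbhs_infty_gtr.
by rewrite mulrDl mul1r; move: uh; lra.
Unshelve. all: by end_near. Qed.

Lemma lip_const_cvg (R : realType) (T : finType) (G : sgraph T) :
  cvgn (fun h : nat => h%:R^-1 *
    (card_Lip G h)%:R `^ ((#|T| - num_components G)%N%:R^-1) : R).
Proof.
apply: cvgn_almost_monotone => [h|h k h0 k0].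
  by rewrite mulr_ge0 ?invr_ge0 ?powR_ge0.
(* With this [m], the product [h * m] exceeds [k], but by at most [h]. *)
set N := (#|T| - num_components G)%N; set m := (k %/ h).+1.
have kR : 0 < k%:R :> R by rewrite ltr0n.
have hR : 0 < h%:R :> R by rewrite ltr0n.
have mk : m%:R * h%:R <= k%:R + h%:R :> R.
  by rewrite -natrM -natrD ler_nat /m mulSn addnC leq_add2r leq_trunc_div.
have ak : (card_Lip G k)%:R `^ N%:R^-1 <= m%:R * (card_Lip G h)%:R `^ N%:R^-1 :> R.
  have : (card_Lip G k <= card_Lip G h * m ^ N)%N.
    apply: leq_trans (card_Lip_mul _ _ _) => //; apply: card_Lip_mono.
    by rewrite /m mulnC ltnW // ltn_ceil.
  rewrite -(ler_nat R) natrM => H.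
  apply: (@le_trans _ _ (((card_Lip G h)%:R * (m ^ N)%:R) `^ N%:R^-1)).
    by apply: ge0_ler_powR; rewrite ?nnegrE ?invr_ge0 ?mulr_ge0.
  rewrite powRM // mulrC ler_wpM2r ?powR_ge0 // natrX -powR_mulrn // -powRrM.
  (* For an edgeless graph the exponent [N%:R^-1] is 0 by convention, and the claim reads
     [1 <= m]. *)
  have [->|N0] := eqVneq N 0%N; first by rewrite mul0r powRr0 ler1n.
  by rewrite divff ?pnatr_eq0 // powRr1.
apply: (@le_trans _ _ (k%:R^-1 * (m%:R * (card_Lip G h)%:R `^ N%:R^-1))).
  by rewrite ler_wpM2l // invr_ge0.
rewrite !mulrA ler_wpM2r ?powR_ge0 //.
have -> : (1 + h%:R / k%:R) / h%:R = (k%:R + h%:R) / (k%:R * h%:R) :> R by field; lra.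
by rewrite ler_pdivlMr ?mulr_gt0 // mulrCA -mulrA mulVKf ?gt_eqF.
Qed.

(** * Counting conflict-free assignments *)

Definition upd (T A : finType) (f : {ffun T -> A}) (v : T) (a : A) : {ffun T -> A} :=
  [ffun x => if x == v then a else f x].

(** The value at [v] is uniform on [O]: exchanging it with an element of [B] is injective on
    pairs. *)
Lemma card_upd (T A : finType) (O : {set {ffun T -> A}}) (B : {set A}) v :
  (forall f a, f \in O -> upd f v a \in O) ->
  (#|O| * #|B| <= #|[set f in O | f v \in B]%SET| * #|A|)%N.
Proof.
move=> Ov; rewrite -cardsX -cardsT -cardsX.
rewrite -(@card_in_imset _ _ (fun fb : {ffun T -> A} * A => (upd fb.1 v fb.2, fb.1 v))).
  apply/subset_leq_card/fintype.subsetP => _ /imsetP[[f b] /setXP[/= fO bB] ->].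
  by rewrite !inE /= Ov // ffunE eqxx bB.
move=> [f a] [g b] _ _ [/= /ffunP H fg].
have := H v; rewrite !ffunE eqxx => ->; congr pair; apply/ffunP => x.
by have := H x; rewrite !ffunE; case: eqP => // ->.
Qed.

(** The same exchange at two coordinates, whose values are jointly uniform on [O]. *)
Lemma card_upd2 (T A : finType) (O : {set {ffun T -> A}}) (Q : rel A) u v :
  u != v ->
  (forall f a, f \in O -> upd f u a \in O) ->
  (forall f a, f \in O -> upd f v a \in O) ->
  (#|[set f in O | Q (f u) (f v)]%SET| * #|A| ^ 2 <=
   #|O| * #|[set ab : A * A | Q ab.1 ab.2]%SET|)%N.
Proof.
move=> uv Ou Ov; rewrite -mulnn -card_prod -cardsT -!cardsX.
rewrite -(@card_in_imset _ _ (fun fb : {ffun T -> A} * (A * A) =>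
   (upd (upd fb.1 u fb.2.1) v fb.2.2, (fb.1 u, fb.1 v)))).
  apply/subset_leq_card/fintype.subsetP => _ /imsetP[[f [a b]] /setXP[/= fOQ _] ->].
  by move: fOQ; rewrite !inE /= => /andP[fO ->]; rewrite andbT; apply/Ov/Ou.
move=> [f [a b]] [g [a' b']] _ _ [/= /ffunP H fgu fgv].
have := H v; rewrite !ffunE eqxx => ->.
have := H u; rewrite !ffunE (negbTE uv) eqxx => ->; congr pair; apply/ffunP => x.
by have := H x; rewrite !ffunE; case: (eqVneq x v) => [->//|_]; case: (eqVneq x u) => [->|].
Qed.

(** [S] restricts the constraints and not the domain: values outside [S] stay free, so different [S]
    are compared within one function space. *)
Definition conflict_free (T A : finType) (e : rel T) (bad : rel A) (hi : {set T})
    (mid : {set A}) (S : {set T}) : {set {ffun T -> A}} :=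
  [set f : {ffun T -> A} | [forall x in S, (x \in hi) ==> (f x \in mid)] &&
     [forall x in S, forall y in S, e x y ==> ~~ bad (f x) (f y)]]%SET.

Lemma conflict_freeP (T A : finType) (e : rel T) (bad : rel A)
    (hi : {set T}) (mid : {set A})
    (S : {set T}) (f : {ffun T -> A}) :
  reflect ((forall x, x \in S -> x \in hi -> f x \in mid) /\
           (forall x y, x \in S -> y \in S -> e x y -> ~~ bad (f x) (f y)))
          (f \in conflict_free e bad hi mid S).
Proof.
rewrite inE; apply: (iffP andP) => -[H1 H2]; split.
- by move=> x xS; apply/implyP; exact: (forall_inP H1).
- by move=> x y xS yS; apply/implyP; exact: (forall_inP (forall_inP H2 _ xS) _ yS).
- by apply/forall_inP => x xS; apply/implyP; apply: H1.
- apply/forall_inP => x xS; apply/forall_inP => y yS; apply/implyP; exact: H2.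
Qed.

Lemma conflict_free_upd (T A : finType) (e : rel T) (bad : rel A)
    (hi : {set T}) (mid : {set A})
    (S : {set T}) (f : {ffun T -> A}) v a :
  v \notin S -> f \in conflict_free e bad hi mid S ->
  upd f v a \in conflict_free e bad hi mid S.
Proof.
move=> vS /conflict_freeP[H1 H2].
have neq x : x \in S -> (x == v) = false.
  by move=> xS; apply/negP => /eqP xv; rewrite -xv xS in vS.
apply/conflict_freeP; split=> [x xS|x y xS yS]; rewrite !ffunE ?(neq x xS) ?(neq y yS).
  exact: H1.
exact: H2.
Qed.

Lemma conflict_free_sub (T A : finType) (e : rel T) (bad : rel A) (hi : {set T})
    (mid : {set A}) (S S' : {set T}) :
  S \subset S' ->
  conflict_free e bad hi mid S' \subset conflict_free e bad hi mid S.
Proof.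
move=> /fintype.subsetP sS; apply/fintype.subsetP => f /conflict_freeP[H1 H2].
apply/conflict_freeP; split=> [x /sS|x y /sS xS /sS yS]; [exact: H1|exact: H2].
Qed.

Lemma conflict_free_hi (R : realType) (T A : finType) (e : rel T) (bad : rel A)
    (hi : {set T}) (mid : {set A})
    (mu : R) (S : {set T}) v :
  symmetric bad -> irreflexive e -> (forall a b, a \in mid -> ~~ bad a b) ->
  (0 < #|A|)%N -> mu * #|A|%:R <= #|mid|%:R -> v \notin S -> v \in hi ->
  mu * #|conflict_free e bad hi mid S|%:R <=
  #|conflict_free e bad hi mid (v |: S)%SET|%:R.
Proof.
move=> bads ei badm A0 muA vS vhi; set O := conflict_free _ _ _ _ S.
have H : (#|O| * #|mid| <= #|conflict_free e bad hi mid (v |: S)%SET| * #|A|)%N.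
  apply: leq_trans (card_upd mid (fun f a => @conflict_free_upd _ _ e bad hi mid S f v a vS)) _.
  rewrite leq_mul2r; apply/orP; right; apply/subset_leq_card/fintype.subsetP => f.
  rewrite inE => /andP[/conflict_freeP[H1 H2] fv].
  apply/conflict_freeP; split=> [x|x y]; rewrite !inE.
    by case/orP => [/eqP->//|]; exact: H1.
  case/orP=> [/eqP->|xS] /orP[/eqP->|yS]; rewrite ?ei // => exy.
  - exact: badm.
  - by rewrite bads badm.
  - exact: H2.
have A0R : 0 < #|A|%:R :> R by rewrite ltr0n.
rewrite -(ler_pM2r A0R); move: H; rewrite -(ler_nat R) !natrM; apply: le_trans.
by rewrite mulrAC mulrC ler_wpM2l.
Qed.

Definition nbrs (T : finType) (e : rel T) (S : {set T}) v : nat :=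
  #|[set u in S | e v u]%SET|.

(* Rosenfeld's counting argument: the assignments on S that conflict at v with
   the value of a neighbour u are counted by releasing u, which by induction
   costs at most the factor expR (lam * D). *)
Lemma conflict_free_lo (R : realType) (T A : finType) (e : rel T) (bad : rel A)
    (hi : {set T}) (mid : {set A})
    (lam D : R) (S : {set T}) v :
  symmetric bad -> symmetric e -> irreflexive e -> (forall a b, a \in mid -> ~~ bad a b) ->
  (0 < #|A|)%N -> 0 <= lam ->
  (forall u, u \notin hi -> (nbrs e [set: T] u)%:R <= D) ->
  #|[set ab : A * A | bad ab.1 ab.2]%SET|%:R <=
    lam * expR (- (2 * lam * D)) * #|A|%:R ^+ 2 ->
  v \notin S -> v \notin hi ->
  expR (- (lam * (nbrs e S v)%:R)) * #|conflict_free e bad hi mid S|%:R <=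
  #|conflict_free e bad hi mid (v |: S)%SET|%:R.
Proof.
move=> bads es ei badm A0 lam0 degD badW.
have nbrsD U u : u \notin hi -> (nbrs e U u)%:R <= D.
  move=> uh; apply: le_trans (degD u uh); rewrite ler_nat; apply: subset_leq_card.
  by apply/fintype.subsetP => x; rewrite !inE => /andP[].
have [k] := ubnP #|S|; elim: k S v => // k IH S v; rewrite ltnS => Sk vS vhi.
set O := conflict_free e bad hi mid S; set O' := conflict_free e bad hi mid _.
pose c : R := lam * expR (- (lam * D)) * #|O|%:R.
have A0R : 0 < #|A|%:R :> R by rewrite ltr0n.
have clash u : u \in S -> u != v -> #|[set f in O | bad (f u) (f v)]%SET|%:R <= c.
  (* A neighbour in [hi] takes a value in [mid], which conflicts with nothing. *)
  move=> uS uv; have [uh|uh] := boolP (u \in hi).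
    rewrite (_ : [set _ in _ | _]%SET = finset.set0) ?cards0 ?mulr_ge0 ?expR_ge0 //.
    apply/setP => f; rewrite !inE; apply/negP => /andP[/andP[/forall_inP/(_ u uS)]].
    by rewrite uh /= => /badm fm _; apply/negP.
  have uSu : u \notin (S :\ u)%SET by rewrite !inE eqxx.
  have vSu : v \notin (S :\ u)%SET by rewrite !inE negb_and vS orbT.
  have SuS : (u |: (S :\ u) = S)%SET by rewrite finset.setD1K.
  have Ok : #|conflict_free e bad hi mid (S :\ u)%SET|%:R <= expR (lam * D) * #|O|%:R.
    have := IH (S :\ u)%SET u _ uSu uh; rewrite SuS -/O => /(_ _)IHu.
    rewrite -ler_pdivrMl ?expR_gt0 // -expRN.
    apply: le_trans (IHu _); last by move: Sk; rewrite (cardsD1 u S) uS add1n.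
    by rewrite ler_wpM2r // ler_expR lerN2 ler_wpM2l ?nbrsD.
  have := card_upd2 bad uv
    (fun f a => @conflict_free_upd _ _ e bad hi mid _ f u a uSu)
    (fun f a => @conflict_free_upd _ _ e bad hi mid _ f v a vSu).
  rewrite -(ler_nat R) !natrM -expr2 => H.
  have A2 : 0 < #|A|%:R ^+ 2 :> R by rewrite exprn_gt0.
  rewrite -(ler_pM2r A2); apply: (le_trans _ (le_trans H _)).
    rewrite (ler_pM2r A2) ler_nat; apply/subset_leq_card/fintype.subsetP => f.
    rewrite !(in_setI, inE) => /andP[fO ->]; rewrite andbT -inE.
    have := conflict_free_sub e bad hi mid (subD1set S u).
    by move=> /fintype.subsetP/(_ f); rewrite !inE; apply.
  apply: le_trans (ler_pM _ _ Ok badW) _ => //.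
  (* Releasing [u] costs [expR (lam * D)]; the factor [expR (- (2 * lam * D))] in [badW] pays for it
     and leaves [expR (- (lam * D))]. *)
  have EE : expR (- (lam * D)) = expR (lam * D) * expR (- (2 * lam * D)) :> R.
    by rewrite -expRD; congr expR; ring.
  by rewrite /c EE le_eqVlt; apply/orP; left; apply/eqP; ring.
(* Union bound: an assignment lost on adding [v] conflicts at [v] with some neighbour in [S]. *)
have cover : (#|O| <= #|O'| + \sum_(u in [set u in S | e v u]%SET)
     #|[set f in O | bad (f u) (f v)]%SET|)%N.
  rewrite -!sum1_card (big_mkcond (mem O')) /=.
  under [X in (_ + X)%N]eq_bigr => u _ do rewrite -sum1_card big_mkcond.
  rewrite exchange_big -big_split /= big_mkcond; apply: leq_sum => f _.
  case: ifP => // fO; case: (boolP (f \in O')) => //; apply: contraNT.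
  rewrite add0n -eqn0Ngt sum_nat_eq0 => /forall_inP fu.
  have /conflict_freeP[H1 H2] := fO.
  have nb u : u \in S -> e v u -> ~~ bad (f u) (f v).
    move=> uS vu; apply/negP => fb; have uv : u \in [set u in S | e v u]%SET by rewrite inE uS vu.
    have fOb : f \in [set f in O | bad (f u) (f v)]%SET by rewrite finset.in_set fO fb.
    by have := fu u uv; rewrite fOb.
  apply/conflict_freeP; split=> [x|x y]; rewrite !inE.
    by case/orP => [/eqP->|]; [rewrite (negbTE vhi)|exact: H1].
  case/orP=> [/eqP->|xS] /orP[/eqP->|yS]; rewrite ?ei // => exy.
  - by rewrite bads nb.
  - by rewrite nb // es.
  - exact: H2.
have tD := nbrsD S v vhi; set t : R := (nbrs e S v)%:R.
have {}cover : #|O|%:R <= #|O'|%:R + t * c.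
  have -> : t * c = \sum_(u in [set u in S | e v u]%SET) c.
    by rewrite sumr_const mulr_natl.
  move: cover; rewrite -(ler_nat R) => /le_trans; apply.
  rewrite natrD lerD2l natr_sum; apply: ler_sum => u; rewrite inE => /andP[uS _].
  by apply: clash => //; apply: contraNneq vS => <-.
have ct : t * c <= lam * t * expR (- (lam * t)) * #|O|%:R.
  rewrite /c !mulrA (mulrC t lam) ler_wpM2r // ler_wpM2l ?mulr_ge0 //.
  by rewrite ler_expR lerN2 ler_wpM2l.
(* With [x = lam * t], the surviving fraction is at least [1 - x * expR (- x)], hence at least
   [expR (- x)]. *)
have ey : (1 + lam * t) * expR (- (lam * t)) <= 1.
  by rewrite expRN ler_pdivrMr ?expR_gt0 // mul1r expR_ge1Dx.
have O0 : 0 <= #|O|%:R :> R by [].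
have := ler_wpM2r O0 ey; lra.
Qed.

Lemma nbrsE (T : finType) (e : rel T) (S : {set T}) v :
  nbrs e S v = (\sum_(u in S) e v u)%N.
Proof.
rewrite /nbrs -sum1_card big_mkcond [RHS]big_mkcond; apply: eq_bigr => u _.
by rewrite inE; case: (u \in S); case: (e v u).
Qed.

Lemma sum_nbrs_setU1 (T : finType) (e : rel T) (S : {set T}) v :
  symmetric e -> irreflexive e -> v \notin S ->
  (\sum_(x in v |: S) nbrs e (v |: S) x = \sum_(x in S) nbrs e S x + (nbrs e S v).*2)%N.
Proof.
move=> es ei vS.
have nU x : nbrs e (v |: S) x = (e x v + nbrs e S x)%N by rewrite !nbrsE big_setU1.
rewrite big_setU1 //= nU ei add0n.
under eq_bigr => x _ do rewrite nU es.
by rewrite big_split /= -nbrsE addnA addnn addnC.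
Qed.

(** Vertices are added one by one in any order. Each edge is charged once, at its later endpoint,
    which gives half the degree sum. *)
Lemma card_conflict_free (R : realType) (T A : finType) (e : rel T) (bad : rel A)
    (hi : {set T}) (mid : {set A}) (lam mu D : R) :
  symmetric bad -> symmetric e -> irreflexive e -> (forall a b, a \in mid -> ~~ bad a b) ->
  (0 < #|A|)%N -> 0 <= lam -> 0 <= mu -> mu * #|A|%:R <= #|mid|%:R ->
  (forall u, u \notin hi -> (nbrs e [set: T] u)%:R <= D) ->
  #|[set ab : A * A | bad ab.1 ab.2]%SET|%:R <=
    lam * expR (- (2 * lam * D)) * #|A|%:R ^+ 2 ->
  #|A|%:R ^+ #|T| * mu ^+ #|hi| *
    expR (- (lam * ((\sum_v nbrs e [set: T] v)%:R / 2))) <=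
  #|conflict_free e bad hi mid [set: T]|%:R.
Proof.
move=> bads es ei badm A0 lam0 mu0 muA degD badW.
suff H S : #|A|%:R ^+ #|T| * mu ^+ #|(hi :&: S)%SET| *
    expR (- (lam * ((\sum_(v in S) nbrs e S v)%N%:R / 2))) <=
    #|conflict_free e bad hi mid S|%:R.
  have := H [set: T]%SET; rewrite finset.setIT.
  by rewrite (eq_bigl xpredT) // => x; rewrite inE.
have [k] := ubnP #|S|; elim: k S => // k IH S; rewrite ltnS => Sk.
have [->|[v vS]] := set_0Vmem S.
  rewrite finset.setI0 cards0 expr0 mulr1 big_set0 mul0r mulr0 oppr0 expR0 mulr1.
  rewrite -natrX ler_nat -card_ffun -cardsT; apply/subset_leq_card/fintype.subsetP => f _.
  by apply/conflict_freeP; split=> [x|x y]; rewrite inE.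
have vSv : v \notin (S :\ v)%SET by rewrite !inE eqxx.
rewrite -(finset.setD1K vS) sum_nbrs_setU1 //.
have S'k : (#|S :\ v|%SET < k)%N by move: Sk; rewrite (cardsD1 v S) vS add1n.
have := IH _ S'k; set S' := (S :\ v)%SET in vSv *; set E := (\sum_(x in S') _)%N.
move=> {}IH.
have eE : expR (- (lam * ((E + (nbrs e S' v).*2)%:R / 2))) =
    expR (- (lam * (E%:R / 2))) * expR (- (lam * (nbrs e S' v)%:R)) :> R.
  by rewrite -expRD; congr expR; rewrite natrD -muln2 natrM; field.
rewrite eE.
(* Edges charged at a vertex of [hi] cost nothing in the count; their factor in the bound is
   discarded. *)
have e1 : expR (- (lam * (nbrs e S' v)%:R)) <= 1 :> R.
  by rewrite -expR0 ler_expR oppr_le0 mulr_ge0.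
have [vhi|vhi] := boolP (v \in hi).
  have -> : #|hi :&: (v |: S')|%SET = #|hi :&: S'|%SET.+1.
    rewrite (cardsD1 v) !inE vhi eqxx add1n; congr _.+1; apply: eq_card => x.
    by rewrite !inE; case: (x == v); rewrite ?andbF.
  apply: le_trans (conflict_free_hi bads ei badm A0 muA vSv vhi).
  apply: le_trans (ler_wpM2l mu0 IH); rewrite exprS.
  set a := _ ^+ _; set b := mu ^+ _; set c := expR _; set t := expR _ in e1 *.
  rewrite [leRHS](_ : _ = a * (mu * b) * (c * 1)); last by ring.
  by rewrite ler_wpM2l ?mulr_ge0 ?exprn_ge0 // ler_wpM2l ?expR_ge0.
have -> : #|hi :&: (v |: S')|%SET = #|hi :&: S'|%SET.
  apply: eq_card => x; rewrite !inE; case: (eqVneq x v) => [->|//].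
  by rewrite (negbTE vhi).
apply: le_trans (conflict_free_lo bads es ei badm A0 lam0 degD badW vSv vhi).
apply: le_trans (ler_wpM2l (expR_ge0 _) IH).
by rewrite [leRHS]mulrC !mulrA.
Qed.

(** * Far pairs and central values in an interval *)

Definition far (h m : nat) : rel 'I_m := fun a b => (a + h < b)%N || (b + h < a)%N.

(* Reduction modulo h is injective on far pairs and maps them below e.+1. *)
Lemma card_far (h e : nat) : (e < h)%N ->
  (#|[set ab : 'I_(h + e.+1) * 'I_(h + e.+1) | far h ab.1 ab.2]%SET| <= e.+1 ^ 2)%N.
Proof.
move=> eh.
rewrite -(@card_in_imset _ _ (fun ab : 'I_(h + e.+1) * 'I_(h + e.+1) =>
   (inord (ab.1 %% h) : 'I_e.+1, inord (ab.2 %% h) : 'I_e.+1))).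
  by apply: leq_trans (max_card _) _; rewrite card_prod !card_ord mulnn.
have modlo (a b : 'I_(h + e.+1)) : (a + h < b)%N ->
    [/\ (a %% h = a)%N, (b %% h = b - h)%N, (a < b - h)%N & (b - h < e.+1)%N].
  move=> ab; have := ltn_ord b => bh.
  have hb : (h <= b)%N by lia.
  split; [by rewrite modn_small //; lia| |lia|lia].
  by rewrite -{1}(subnK hb) modnDr modn_small //; lia.
have ltmod (a b : 'I_(h + e.+1)) : far h a b -> (a %% h < e.+1)%N && (b %% h < e.+1)%N.
  by case/orP => /modlo[-> -> ? ?]; apply/andP; split=> //; lia.
move=> [a b] [a' b']; rewrite !inE /= => Fab Fab'.
case=> [/(congr1 (@nat_of_ord _)) E1 /(congr1 (@nat_of_ord _)) E2].
have /andP[m1 m2] := ltmod _ _ Fab; have /andP[m3 m4] := ltmod _ _ Fab'.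
rewrite !inordK // in E1 E2.
suff [Ea Eb] : a = a' :> nat /\ b = b' :> nat by congr pair; apply: val_inj.
(* In a far pair the smaller value has the smaller residue, so the residues reveal the order and the
   two mixed cases are impossible. *)
have same x y x' y' : (x < y - h -> x' < y' - h -> x = x' -> y - h = y' - h ->
    x = x' /\ y = y')%N by clear; lia.
have opposite x y x' y' : (x < y - h -> y' < x' - h -> x = x' - h -> y - h <> y')%N.
  by clear; lia.
move: E1 E2; case/orP: Fab => /modlo[-> -> ab _]; case/orP: Fab' => /modlo[-> -> ab' _] E1 E2.
- exact: same.
- by have := opposite _ _ _ _ ab ab' E1 E2.
- by have := opposite _ _ _ _ ab ab' E2 E1.
- by have [] := same _ _ _ _ ab ab' E2 E1.
Qed.

Definition central (h m e : nat) : {set 'I_m} := [set a : 'I_m | (e <= a < h)%N]%SET.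

Lemma far_central (h e : nat) (a b : 'I_(h + e)) : a \in central h (h + e) e -> ~~ far h a b.
Proof. by rewrite inE /far => ?; have := ltn_ord b; lia. Qed.

Lemma card_central (h e : nat) : (h - e <= #|central h (h + e) e|)%N.
Proof.
have lt (i : 'I_(h - e)) : (e + i < h + e)%N by have := ltn_ord i; lia.
rewrite -[leqLHS]card_ord -cardsT.
rewrite -(@card_in_imset _ _ (fun i => Ordinal (lt i))).
  apply/subset_leq_card/fintype.subsetP => _ /imsetP[i _ ->].
  by rewrite inE /=; have := ltn_ord i; lia.
by move=> i j _ _ [/addnI]; exact: val_inj.
Qed.

(** * Fixed vertices, components and the passage to Lipschitz functions *)

Lemma card_fixed (T : finType) (G : sgraph T) : #|fixed_vertices G| = num_components G.
Proof. by apply: eq_card => x; rewrite !inE andbT. Qed.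

Lemma adj_connect_sym (T : finType) (G : sgraph T) : connect_sym (adj G).
Proof. exact/sym_connect_sym/adj_sym. Qed.

(* Normalising an assignment at the fixed vertices loses only its values there. *)
Lemma card_conflict_free_Lip (T : finType) (G : sgraph T) (h m : nat)
    (hi : {set T}) (mid : {set 'I_m}) :
  (#|conflict_free (adj G) (@far h m) hi mid [set: T]| <=
   card_Lip G h * m ^ num_components G)%N.
Proof.
set O := conflict_free _ _ _ _ _.
rewrite -card_fixed -(card_sig (mem O)).
have -> : (m ^ #|fixed_vertices G|)%N = #|{ffun {x | x \in fixed_vertices G} -> 'I_m}|.
  by rewrite card_ffun card_ord card_sig.
apply: (@leq_card_fset_set _ _ _ _
  (fun f : {f | f \in O} =>
     [ffun x => (val f x)%:Z - (val f (fingraph.root (adj G) x))%:Z])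
  (fun f => [ffun x => val f (val x)])).
- exact: finite_Lip.
- move=> [f fO]; split=> [x|x y xy]; rewrite !ffunE /=.
    by rewrite inE => /eqP->; rewrite subrr.
  have -> : fingraph.root (adj G) x = fingraph.root (adj G) y.
    by apply/(fingraph.rootP (adj_connect_sym G)); rewrite connect1.
  have /conflict_freeP[_ /(_ x y)] := fO; rewrite !inE => /(_ isT isT xy).
  rewrite /far; move: (f x : nat) (f y : nat) (f _ : nat) => a b c; lia.
move=> f g /ffunP fg1 /ffunP fg2; apply/val_inj/ffunP => x.
have rx : fingraph.root (adj G) x \in fixed_vertices G.
  by rewrite inE roots_root //; exact: adj_connect_sym.
have := fg2 (exist (fun x => x \in fixed_vertices G) _ rx); rewrite !ffunE /= => E.
have := fg1 x; rewrite !ffunE E => /addIr [].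
exact: val_inj.
Qed.

Lemma degree_nbrs (T : finType) (G : sgraph T) v :
  degree (edges G) v = nbrs (adj G) [set: T] v.
Proof.
rewrite nbrsE /degree big_mkcond [RHS]big_mkcond; apply: eq_bigr => u _.
rewrite inE -/(adj G v u); case: eqVneq => //= ->; by rewrite adj_irrefl.
Qed.

(* Closed neighbourhoods of vertices in distinct components are disjoint. *)
Lemma sum_degree_fixed (T : finType) (G : sgraph T) :
  (\sum_(x in fixed_vertices G) degree (edges G) x <= #|T|)%N.
Proof.
under eq_bigr => x _ do rewrite degree_nbrs nbrsE.
rewrite exchange_big /= -sum1_card (eq_bigl xpredT); last by move=> x; rewrite inE.
apply: leq_sum => u _.
rewrite (bigID (pred1 (fingraph.root (adj G) u))) /= [X in (_ + X)%N]big1 ?addn0.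
  apply: leq_trans (_ : \sum_(i | i == fingraph.root (adj G) u) 1 <= _)%N; last first.
    by rewrite big_pred1_eq.
  rewrite big_mkcond [leqRHS]big_mkcond; apply: leq_sum => i _.
  by case: (i == _); rewrite ?andbF // andbT; case: ifP => // _; case: (adj _ _ _).
move=> x /andP[]; rewrite inE => /eqP rx; apply: contraNeq; rewrite eqb0 negbK => xu.
rewrite -[x in x == _]rx; apply/eqP/(fingraph.rootP (adj_connect_sym G)).
exact: connect1.
Qed.

Definition atypical_set (R : realType) (T : finType) (G : sgraph T) (d : R) : {set T} :=
  [set v | atypical d (degree (edges G) v)]%SET.

(** A fixed vertex is atypical or has degree at least [d / 2], and the degrees of the fixed vertices
    sum to at most [#|T|]. *)
Lemma num_components_le (R : realType) (T : finType) (G : sgraph T) (d : R) :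
  0 < d ->
  (num_components G)%:R <= #|atypical_set G d|%:R + 2 * #|T|%:R / d.
Proof.
move=> d0; have := sum_degree_fixed G; rewrite -(ler_nat R) natr_sum => H.
rewrite -card_fixed -sum1_card natr_sum.
apply: (@le_trans _ _ (\sum_(x in fixed_vertices G)
    ((x \in atypical_set G d)%:R + 2 / d * (degree (edges G) x)%:R))).
  apply: ler_sum => x _; rewrite inE /atypical.
  have k0 : 0 <= (degree (edges G) x)%:R :> R by [].
  case: ltP => /= [_|]; first by rewrite lerDl mulr_ge0 // divr_ge0 // ltW.
  rewrite add0r ler_norml => /andP[? _].
  by rewrite mulrAC ler_pdivlMr //; lra.
rewrite big_split -mulr_sumr /= lerD //.
  rewrite -natr_sum ler_nat -sum1_card [leqRHS]big_mkcond [leqLHS]big_mkcond.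
  by apply: leq_sum => x _; case: (x \in fixed_vertices G); case: (x \in _).
by rewrite mulrAC -!mulrA ler_wpM2l // mulrC [leRHS]mulrC ler_wpM2l // invr_ge0 ltW.
Qed.

(** * The lower bound *)

Lemma expR_le_inv (R : realType) (x : R) : x < 1 -> expR x <= (1 - x)^-1.
Proof.
move=> x1; rewrite -[x]opprK expRN opprK lef_pV2 ?posrE ?expR_gt0 ?subr_gt0 //.
exact: expR_ge1Dx.
Qed.

(** For [y = d^-1], converts the relative length of the value interval into an exponent per
    vertex. *)
Lemma expR_quadratic_le (R : realType) (y : R) :
  0 <= y -> y <= 1 / 12 -> expR (y - 2 * y ^+ 2) <= 1 + y - y ^+ 2.
Proof.
move=> y0 y1; apply: le_trans (expR_le_inv _) _; first nra.
rewrite -div1r ler_pdivrMr; last nra.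
have -> : (1 + y - y ^+ 2) * (1 - (y - 2 * y ^+ 2)) = 1 + y ^+ 3 * (3 - 2 * y) by ring.
by rewrite lerDl mulr_ge0 ?exprn_ge0 //; lra.
Qed.

Lemma central_mass (R : realType) (d h e : R) :
  12 <= d -> 0 < h -> e <= h / d -> expR (- (3 / d)) * (h + e) <= h - e.
Proof.
move=> d12 h0 ed; set y := d^-1; rewrite -/y in ed *.
have y0 : 0 < y by rewrite invr_gt0; lra.
have y1 : y <= 1 / 12 by rewrite div1r lef_pV2 ?posrE; lra.
have H : expR (- (3 * y)) * (1 + y) <= 1 - y.
  apply: (@le_trans _ _ ((1 + 3 * y)^-1 * (1 + y))).
    rewrite ler_wpM2r //; first lra.
    by apply: le_trans (expR_le_inv _) _; rewrite ?opprK //; lra.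
  by rewrite ler_pdivrMl; nra.
have e0 := expR_ge0 (- (3 * y)); move: (expR _) e0 H => a a0 H.
apply: (@le_trans _ _ (a * (h * (1 + y)))); first by rewrite ler_wpM2l //; nra.
nra.
Qed.

(** Far pairs have proportion at most [d^-1 ^+ 2]. With [y = d^-1] the exponential loses at most
    [expR (6 * y)], which the correction [1 + 12 * y] in the rate absorbs. *)
Lemma expR_rate (R : realType) (d : R) :
  12 <= d -> d^-1 ^+ 2 <=
  (1 + 12 / d) / d ^+ 2 * expR (- (2 * ((1 + 12 / d) / d ^+ 2) * (3 * d / 2))).
Proof.
move=> d12; set y := d^-1.
have y0 : 0 < y by rewrite invr_gt0; lra.
have y1 : y <= 1 / 12 by rewrite div1r lef_pV2 ?posrE; lra.
have -> : 2 * ((1 + 12 * y) / d ^+ 2) * (3 * d / 2) = 3 * (1 + 12 * y) * y.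
  by rewrite /y; field; lra.
rewrite exprVn mulrAC ler_pMl ?invr_gt0 ?exprn_gt0 //; last lra.
rewrite expRN ler_pdivlMr ?expR_gt0 // mul1r.
apply: le_trans (_ : expR (6 * y) <= _); first by rewrite ler_expR; nra.
apply: le_trans (expR_le_inv _) _; first lra.
rewrite -div1r ler_pdivrMr; nra.
Qed.

(** Here [y] is [d^-1], and [K], [B], [m] count components, atypical vertices and edges. The weight
    in the cost makes the coefficient of [B] nonnegative. The quadratic losses are
    [2 + 2 + 6 + 33 = 43], and the cubic ones add less than 33 since [y <= 1 / 12]; hence 76. *)
Lemma exponent_bound (R : realType) (y n K B m : R) :
  0 < y -> y <= 1 / 12 -> 0 <= n -> 0 <= B -> K <= B + 2 * n * y ->
  m + 4 * y^-1 * B <= n * (y^-1 / 2 + 33) ->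
  n * (y / 2 - 76 * y ^+ 2) <=
  (y - 2 * y ^+ 2) * (n - K) + (- (3 * y) * B - (1 + 12 * y) * y ^+ 2 * m).
Proof.
move=> y0 y1 n0 B0 KB cost.
have x0 : 0 <= y - 2 * y ^+ 2 by nra.
have HK := ler_wpM2l x0 KB.
have lam0 : 0 <= (1 + 12 * y) * y ^+ 2 by rewrite mulr_ge0 ?sqr_ge0 //; lra.
have := ler_wpM2l lam0 cost.
have -> : (1 + 12 * y) * y ^+ 2 * (m + 4 * y^-1 * B) =
    (1 + 12 * y) * y ^+ 2 * m + 4 * ((1 + 12 * y) * y) * B by field; lra.
have -> : (1 + 12 * y) * y ^+ 2 * (n * (y^-1 / 2 + 33)) =
    n * ((1 + 12 * y) * y / 2 + 33 * ((1 + 12 * y) * y ^+ 2)) by field; lra.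
have B1 : 0 <= y ^+ 2 * B by rewrite mulr_ge0 ?sqr_ge0.
have n1 : 0 <= n * y ^+ 2 * (1 - 12 * y).
  by rewrite !mulr_ge0 ?sqr_ge0 //; lra.
have n2 : 0 <= n * y ^+ 3 by rewrite mulr_ge0 ?exprn_ge0 // ltW.
have n3 : 0 <= n * y ^+ 2 by rewrite mulr_ge0 ?sqr_ge0.
move: HK; nra.
Qed.

Lemma card_Lip_ge (R : realType) (T : finType) (G : sgraph T) (d : R) (h : nat) :
  12 <= d -> d ^+ 2 <= h%:R ->
  graph_cost d (edges G) <= #|T|%:R * (d / 2 + 33) ->
  h%:R ^+ (#|T| - num_components G) * expR (#|T|%:R * (1 / (2 * d) - 76 / d ^+ 2)) <=
  (card_Lip G h)%:R.
Proof.
move=> d12 dh cost.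
have h0 : 0 < h%:R :> R by apply: lt_le_trans dh; rewrite exprn_gt0 //; lra.
have hd : d <= h%:R / d by rewrite ler_pdivlMr; [rewrite -expr2|lra].
have hd0 : 0 <= h%:R / d by lra.
(* [e.+1] is the integer part of [h%:R / d], nonzero because [h%:R / d] is at least [d]. *)
have [e e1 e2] : exists2 e : nat, e.+1%:R <= h%:R / d & h%:R / d < e.+1%:R + 1.
  have := truncn_itv hd0; set t := Num.truncn _ => /andP[t1 t2].
  case: t t1 t2 => [|t] t1 t2; first by move: t2; lra.
  by exists t; rewrite ?natr1.
have ehR : e.+1%:R <= h%:R :> R.
  by apply: le_trans e1 _; rewrite ler_pdivrMr; nra.
have eh : (e < h)%N by rewrite -(ler_nat R).
pose lam : R := (1 + 12 / d) / d ^+ 2.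
have lam0 : 0 <= lam by rewrite divr_ge0 ?sqr_ge0 ?addr_ge0 ?divr_ge0 //; lra.
pose hi := atypical_set G d.
set M := (h + e.+1)%N.
have M0 : 0 < M%:R :> R by rewrite /M natrD; have : 0 <= e.+1%:R :> R by []; lra.
have := @card_conflict_free R T 'I_M (adj G) (@far h M) hi (central h M e.+1)
  lam (expR (- (3 / d))) (3 * d / 2).
rewrite card_ord => /(_ _ (@adj_sym _ G) (@adj_irrefl _ G) (@far_central h e.+1)).
have -> : (0 < M)%N by rewrite -(ltr_nat R).
rewrite lam0 expR_ge0 => /(_ _ isT isT isT).
have far_sym : symmetric (@far h M) by move=> a b; rewrite /far orbC.
move=> /(_ far_sym).
have mass : expR (- (3 / d)) * M%:R <= #|central h M e.+1|%:R.
  apply: le_trans (_ : (h - e.+1)%N%:R <= _); last by rewrite ler_nat card_central.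
  by rewrite /M natrD natrB // central_mass.
have hiD u : u \notin hi -> (nbrs (adj G) [set: T] u)%:R <= 3 * d / 2.
  rewrite inE /atypical -leNgt degree_nbrs ler_norml => /andP[_]; lra.
have rate : #|[set ab : 'I_M * 'I_M | far h ab.1 ab.2]%SET|%:R <=
    lam * expR (- (2 * lam * (3 * d / 2))) * M%:R ^+ 2.
  apply: le_trans (_ : (d^-1 ^+ 2) * M%:R ^+ 2 <= _); last first.
    by rewrite ler_wpM2r ?sqr_ge0 ?expR_rate.
  apply: le_trans (_ : e.+1%:R ^+ 2 <= _).
    by rewrite -natrX ler_nat card_far.
  rewrite -exprMn lerXn2r ?nnegrE ?mulr_ge0 ?invr_ge0 //; first lra.
  apply: le_trans e1 _; rewrite mulrC ler_wpM2l ?invr_ge0; [by []|lra|].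
  by rewrite /M natrD lerDl.
move=> /(_ mass hiD rate) low.
have upp : #|conflict_free (adj G) (@far h M) hi (central h M e.+1) [set: T]|%:R <=
    (card_Lip G h)%:R * M%:R ^+ num_components G :> R.
  by rewrite -natrX -natrM ler_nat card_conflict_free_Lip.
have {low upp} := le_trans low upp.
set k := num_components G; set n := #|T|; set N := (n - k)%N.
have kn : (k <= n)%N by exact: max_card.
rewrite -{1}(subnK kn) exprD -/N; set P := expR _.
set m : R := _%:R / 2.
(* The factor [M%:R ^+ k], due to the values at the fixed vertices, is isolated in order to cancel
   it. *)
have -> : M%:R ^+ N * M%:R ^+ k * P ^+ #|hi| * expR (- (lam * m)) =
   M%:R ^+ N * (P ^+ #|hi| * expR (- (lam * m))) * M%:R ^+ k.
  by rewrite -(mulrA (_ * _)) mulrAC.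
rewrite ler_pM2r ?exprn_gt0 //; apply: le_trans.
set y := d^-1.
have y0 : 0 < y by rewrite invr_gt0; lra.
have y1 : y <= 1 / 12 by rewrite div1r lef_pV2 ?posrE; lra.
have dy : d = y^-1 by rewrite invrK.
pose x := y - 2 * y ^+ 2.
(* Rounding shortens the interval by at most 1, which is at most [h%:R * y ^+ 2] because
   [d ^+ 2 <= h%:R]. *)
have Mx : h%:R * expR x <= M%:R.
  apply: le_trans (_ : h%:R * (1 + y - y ^+ 2) <= _).
    by rewrite ler_wpM2l // expR_quadratic_le // ltW.
  have : h%:R * y - 1 <= e.+1%:R by rewrite lerBlDr ltW.
  have : 1 <= h%:R * y ^+ 2 by rewrite exprVn ler_pdivlMr ?mul1r // exprn_gt0 //; lra.
  rewrite /M natrD; clearbody y; move: (e.+1%:R) (h%:R) => E H h1 h2.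
  by rewrite mulrBr mulrDr mulr1; lra.
apply: le_trans (_ : (h%:R * expR x) ^+ N * (P ^+ #|hi| * expR (- (lam * m))) <= _); last first.
  rewrite ler_wpM2r ?mulr_ge0 ?exprn_ge0 ?expR_ge0 //.
  by rewrite lerXn2r ?nnegrE ?mulr_ge0 ?expR_ge0.
rewrite exprMn -mulrA ler_wpM2l ?exprn_ge0 //.
rewrite -!expRM_natr -!expRD ler_expR.
have NE : N%:R = n%:R - k%:R :> R by rewrite natrB.
have := num_components_le G (_ : 0 < d); rewrite -/k -/n -/hi => /(_ _)kle.
have {}kle : k%:R <= #|hi|%:R + 2 * n%:R * y by apply: kle; lra.
move: cost; have -> : graph_cost d (edges G) = m + 4 * d * #|hi|%:R.
  rewrite /graph_cost /degree_cost big_split /= -mulr_suml -mulr_sumr; congr (_ + _ * _).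
    by rewrite /m natr_sum; congr (_ * _); apply: eq_bigr => v _; rewrite degree_nbrs.
  rewrite -sum1_card natr_sum [RHS]big_mkcond; apply: eq_bigr => v _.
  by rewrite inE; case: atypical.
rewrite -/n NE; rewrite -[lam](_ : (1 + 12 * y) * y ^+ 2 = _); last by rewrite /lam exprVn.
rewrite [d in 4 * d]dy [d in d / 2]dy => cost.
have -> : 1 / (2 * d) - 76 / d ^+ 2 = y / 2 - 76 * y ^+ 2.
  by rewrite /y; field; lra.
apply: exponent_bound => //.
Qed.

Lemma lip_const_ge (R : realType) (T : finType) (G : sgraph T) (d : R) :
  200 <= d -> (0 < #|T|)%N ->
  graph_cost d (edges G) <= #|T|%:R * (d / 2 + 33) ->
  1 + 1 / (2 * d) - 76 / d ^+ 2 <= lip_const R G.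
Proof.
move=> d200 T0 cost; have T0R : 0 < #|T|%:R :> R by rewrite ltr0n.
have d0 : 0 < d by lra.
set N := (#|T| - num_components G)%N.
(* The cost bound keeps the atypical vertices to about one eighth of all, so there are fewer
   components than vertices and [N%:R^-1] is a true inverse. *)
have N0 : (0 < N)%N.
  rewrite subn_gt0 -(ltr_nat R); apply: le_lt_trans (num_components_le G d0) _.
  set B := #|_|%:R.
  have : 4 * d * B <= #|T|%:R * (d / 2 + 33).
    apply: le_trans cost; rewrite /B -sum1_card natr_sum mulr_sumr big_mkcond /=.
    apply: ler_sum => v _; rewrite inE /degree_cost; case: atypical => /=.
      by rewrite mulr1 lerDr divr_ge0.
    by rewrite mulr0 addr0 divr_ge0.
  move: (#|T|%:R : R) T0R B => n n0 B H.
  rewrite -(ltr_pM2r d0) mulrDl mulfVK ?gt_eqF //.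
  by move: H; nra.
pose c : R := 1 / (2 * d) - 76 / d ^+ 2.
(* Nonnegativity, which needs [d] at least 152, lets the exponent [#|T|%:R * c / N%:R] be bounded
   below by [c]. *)
have c0 : 0 <= c.
  rewrite /c -[76]mulr1 -(divff (lt0r_neq0 d0)).
  rewrite (_ : _ - _ = (d - 152) / (2 * d ^+ 2)); last by field; lra.
  by rewrite divr_ge0 ?mulr_ge0 ?sqr_ge0 //; lra.
apply: limr_ge; first exact: lip_const_cvg.
near=> h.
have dh : d ^+ 2 <= h%:R by near: h; exact: nbhs_infty_ger.
have h0 : 0 < h%:R :> R by apply: lt_le_trans dh; rewrite exprn_gt0.
have d12 : 12 <= d by lra.
rewrite -/N ler_pdivlMl //.
have := card_Lip_ge d12 dh cost; rewrite -/N -/c => low.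
apply: le_trans (_ : (h%:R ^+ N * expR (#|T|%:R * c)) `^ N%:R^-1 <= _); last first.
  by apply: ge0_ler_powR; rewrite ?nnegrE ?invr_ge0 ?mulr_ge0 ?exprn_ge0 ?expR_ge0.
rewrite powRM ?exprn_ge0 ?expR_ge0 // -(powR_mulrn N (ltW h0)).
have NR : 0 < N%:R :> R by rewrite ltr0n.
rewrite -powRrM divff ?gt_eqF // powRr1 ?(ltW h0) // ler_wpM2l ?(ltW h0) // -expRM.
apply: le_trans (_ : expR c <= _).
  by apply: le_trans (expR_ge1Dx _); rewrite /c addrA.
rewrite ler_expR ler_pdivlMr // mulrC ler_wpM2r // ler_nat.
exact: leq_subr.
Unshelve. all: by end_near. Qed.

Theorem theorem3p1p1 (R : realType) :
  exists (r : R -> R) (C d0 : R),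
    [/\ 0 < C, 0 < d0,
        (forall d : R, d0 <= d -> `|r d| <= C / d ^+ 2) &
        (forall d : R, d0 <= d ->
           (fun n : nat =>
              Gnp_Pr (d / n%:R)
                (fun G : sgraph 'I_n =>
                   1 + 1 / (2 * d) + r d <= lip_const R G)) @ \oo --> (1 : R))].
Proof.
exists (fun d => - (76 / d ^+ 2)), 76, 200; split=> // d d200.
  by rewrite normrN ger0_norm // divr_ge0 ?sqr_ge0.
have d1 : 1 <= d by lra.
(* For fixed [d] the failure probability is of order [1 / n]. *)
apply: (@squeeze_cvgr _ _ _ _ (fun n => 1 - d * (1 + 8 * d) ^+ 2 / n%:R) (fun=> 1)).
- near=> n.
  have dn : d <= n%:R by near: n; exact: nbhs_infty_ger.
  have n0 : 0 < n%:R :> R by lra.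
  have p01 : 0 <= d / n%:R <= 1.
    by rewrite divr_ge0 ?ler_pdivrMr ?mul1r //; lra.
  rewrite Gnp_Pr_le1 // andbT.
  apply: le_trans (graph_cost_whp d1 dn) _.
  apply: (le_Gnp_Pr (b := fun F => (graph_cost d F <= n%:R * (d / 2 + 33))%R)) => // G cost.
  apply: lip_const_ge => //; rewrite card_ord //.
  by rewrite -(ltr_nat R).
- rewrite -[X in _ --> X]subr0; apply: cvgB; first exact: cvg_cst.
  rewrite -(mulr0 (d * (1 + 8 * d) ^+ 2)); apply: cvgMr.
  apply/gtr0_cvgV0; last exact: cvgr_idn.
  by near=> n; rewrite ltr0n; near: n; exact: nbhs_infty_gt.
- exact: cvg_cst.
Unshelve. all: by end_near. Qed.
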